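(* Fix $\alpha=p/q\in\mathbb{Q}$, where $p,q$ are integers with $q>0$ and $\gcd(p,q)=1$, and let $\epsilon=\epsilon_R>0$ be a function of $R>0$. Then, in the limit as $R\to\infty$, $$S_\alpha(\epsilon,R)=\frac{\epsilon q^2R^2}{p^2+q^2}+\frac{1}{q^2\epsilon}\left\{\frac{\epsilon q^2R}{\sqrt{p^2+q^2}}\right\}\left(1-\left\{\frac{\epsilon q^2R}{\sqrt{p^2+q^2}}\right\}\right)+O\left(1+(R\epsilon)^2\right),$$ where $\{x\}:=x-\lfloor x\rfloor$ denotes the fractional part of $x$.
   Context: For $\alpha\in\mathbb{R}$, $\epsilon>0$, $R>0$ let $$\mathrm{Sect}_{\alpha,\epsilon}(R):=\{(x,y)\in\mathbb{R}_{>0}\times\mathbb{R}:\ x^2+y^2\le R^2,\ \alpha-\epsilon<y/x<\alpha+\epsilon\}$$ and $$S_\alpha(\epsilon,R):=\#\left(\mathbb{Z}^2\cap \mathrm{Sect}_{\alpha,\epsilon}(R)\right)=\#\{(m,n)\in\mathbb{Z}_{>0}\times\mathbb{Z}: m^2+n^2\le R^2,\ |n-\alpha m|<m\epsilon\}.$$ The quantity $\epsilon=\epsilon_R$ is viewed as a function of $R$. The $O$-notation refers to the limit $R\to\infty$ with $\alpha$ and the function $R\mapsto\epsilon_R$ fixed: the bound holds for all sufficiently large $R$ with an implied constant not depending on $R$. *)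

(* Defs.v *)
From HB Require Import structures.
From mathcomp Require Import all_boot all_order all_algebra finmap.
From mathcomp Require Import all_classical all_reals all_analysis.
From mathcomp Require Import zify lra.

Set Implicit Arguments.
Unset Strict Implicit.
Unset Printing Implicit Defensive.

Import Order.TTheory GRing.Theory Num.Theory.
Import numFieldNormedType.Exports.

Local Open Scope classical_set_scope.
Local Open Scope ring_scope.

Definition Sect (R : realType) (alpha e r : R) : set (R * R) :=
  [set z | [/\ 0 < z.1, z.1 ^+ 2 + z.2 ^+ 2 <= r ^+ 2
             & alpha - e < z.2 / z.1 < alpha + e]].

Definition Zpoints (R : realType) (A : set (R * R)) : set (int * int) :=
  [set z | A (z.1%:~R, z.2%:~R)].

(* [fset_set] of an infinite set is empty, but the set counted here is always
   finite: see [finite_Zpoints_Sect]. *)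
Definition Scount (R : realType) (alpha e r : R) : nat :=
  #|` fset_set (Zpoints (Sect alpha e r))|.

(* Makes the landau notations, which take a [filter_on], usable at [+oo]. *)
Canonical pinfty_filter_on (R : numFieldType) : filter_on R :=
  @FilterType R (pinfty_nbhs R) _.

Definition fracpart (R : realType) (x : R) : R := x - (Num.floor x)%:~R.

Lemma Zpoints_SectE (R : realType) (alpha e r : R) :
  Zpoints (Sect alpha e r) =
  [set z : int * int | [/\ 0 < z.1,
     (z.1%:~R : R) ^+ 2 + z.2%:~R ^+ 2 <= r ^+ 2
     & `|z.2%:~R - alpha * z.1%:~R| < z.1%:~R * e]].
Proof.
have eqv (m n : int) : 0 < m ->
    (alpha - e < (n%:~R : R) / m%:~R < alpha + e) =
    (`|n%:~R - alpha * m%:~R| < m%:~R * e).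
  move=> m0; have mR : 0 < (m%:~R : R) by rewrite ltr0z.
  rewrite ltr_pdivlMr// ltr_pdivrMr// ltr_norml.
  by congr andb; apply/idP/idP => *; lra.
apply/seteqP; split => -[m n]; rewrite /Zpoints /Sect /= ltr0z => -[m0 le_r];
  by [rewrite eqv | rewrite -eqv].
Qed.

Lemma finite_Zpoints_Sect (R : realType) (alpha e r : R) :
  finite_set (Zpoints (Sect alpha e r)).
Proof.
pose N := Num.bound (r ^+ 2).
pose f (i : 'I_N.*2.+1) : int := i%:Z - N%:Z.
have fP (m : int) : (m%:~R : R) ^+ 2 <= r ^+ 2 -> exists i, m = f i.
  move=> le_r.
  have mN : (`|m| <= N)%N.
    have : (`|m|%:R : R) < N%:R.
      apply: le_lt_trans (archi_boundP (sqr_ge0 r)); apply: le_trans le_r.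
      rewrite -rmorphXn/= -[X in _ <= X%:~R]gez0_abs ?sqr_ge0//.
      by rewrite abszX pmulrn ler_nat; case: absz => // k; rewrite leq_pmulr.
    by rewrite ltr_nat => /ltnW.
  have hm : (`|(m + N%:Z)%R| < N.*2.+1)%N by lia.
  by exists (Ordinal hm); rewrite /f /=; lia.
apply: (@sub_finite_set _ _ (range (fun ij => (f ij.1, f ij.2)))); last first.
  by apply: finite_image; exact: finite_finset.
move=> [m n] [/= _ le_r _].
have [i ->] : exists i, m = f i.
  by apply/fP/(le_trans _ le_r); rewrite lerDl sqr_ge0.
have [j ->] : exists j, n = f j.
  by apply/fP/(le_trans _ le_r); rewrite lerDr sqr_ge0.
by exists (i, j).
Qed.

(* Main.v *)
Require Import Defs.
From mathcomp Require Import all_boot all_order all_algebra.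
From mathcomp Require Import all_classical all_reals all_analysis.
From mathcomp Require Import finmap zify ring lra.

Set Implicit Arguments.
Unset Strict Implicit.
Unset Printing Implicit Defensive.

Import Order.TTheory GRing.Theory Num.Theory.
Import numFieldNormedType.Exports.

(** Write [s] for the square root of [p^2 + q^2] and cut the lattice into
    the lines [q n - p m = k], which are parallel to the axis [n / m = p / q] of
    the sector.  As [p] and [q] are coprime, the points of the [k]-th line are
    [(k a + t q, k b + t p)] with [t] an integer, for a fixed [(a, b)] such that
    [q b - p a = 1] (see [mem_strips]); along each line [m] runs through one
    residue class modulo [q].

    On the [k]-th line the condition on the slope is [m > |k| / (q e)].  The
    condition on the norm is, up to a small error, a bound on [m] as well:
    [q (m, n)] is the sum of [m (q, p)], of norm [s m], and of [(0, k)], so its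
    norm is within [|k|] of [s m] ([line_norm_sandwich]).  Hence the count lies
    between the numbers of points with [|k| / (q e) < m <= (q r + c |k|) / s]
    for [c = -1] and for [c = 1] ([Scount_strips]).  The line contributes the
    length of this interval divided by [q], with an error at most [1] from
    rounding and at most [|k|] from replacing [c] by [0]; what remains is
    [max (0, x - |k|) / (q^2 e)] with [x = e q^2 r / s].

    The sector meets only lines with [|k| <= q e r], so the errors add up to
    [O(1 + (r e)^2)].  The main terms sum exactly ([sum_tent]): the sum of
    [max (0, x - |k|)] over all integers [k] is [x^2 + f (1 - f)], where [f] is
    the fractional part of [x], and [x^2 / (q^2 e) = e q^2 r^2 / s^2].  The
    resulting bound, [Scount_estimate], is explicit and holds for every
    [r > 0]. *)

Local Open Scope classical_set_scope.
Local Open Scope ring_scope.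

(** * Integers in an interval *)

Definition int_range (R : realType) (A B : R) : seq int :=
  [seq Num.floor A + 1 + i%:Z
     | i <- iota 0 `|(Num.max 0 (Num.floor B - Num.floor A))%R|%N].

Lemma mem_int_range (R : realType) (A B : R) (t : int) :
  (t \in int_range A B) = (A < t%:~R <= B).
Proof.
rewrite -floor_lt_int -floor_ge_int /int_range.
move: (Num.floor A) (Num.floor B) => fA fB.
apply/mapP/idP => [[i]|/andP[lt_t le_t]].
  by rewrite mem_iota => i_lt ->; case: (leP 0 (fB - fA)) i_lt; lia.
exists `|(t - fA - 1)%R|%N; last lia.
by rewrite mem_iota; case: (leP 0 (fB - fA)); lia.
Qed.

Lemma uniq_int_range (R : realType) (A B : R) : uniq (int_range A B).
Proof. by rewrite map_inj_uniq ?iota_uniq// => i j /addrI []. Qed.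

(** The maximum covers [B < A], where the range is empty although the
    difference of the floors may be negative. *)
Lemma size_int_range (R : realType) (A B : R) :
  `|(size (int_range A B))%:R - Num.max 0 (B - A)| <= 1.
Proof.
rewrite size_map size_iota.
set fA := Num.floor A; set fB := Num.floor B.
have sizeE : (`|(Num.max 0 (fB - fA))%R|%N%:R : R) = Num.max 0 (fB%:~R - fA%:~R).
  rewrite pmulrn gez0_abs ?le_max ?lexx// -rmorphB /=.
  by case: (leP 0 (fB - fA)) => h; case: (leP 0 ((fB - fA)%:~R : R));
    rewrite ?ler0z ?ltrz0 => h' //; move: h h'; lia.
rewrite sizeE.
have := floor_itv A; have := floor_itv B; rewrite -/fA -/fB !rmorphD /=.
move=> /andP[Bl Bu] /andP[Al Au].
rewrite ler_norml; case: (leP 0 (fB%:~R - fA%:~R : R)) => h1;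
  case: (leP 0 (B - A)) => h2; apply/andP; split; lra.
Qed.

(** * Sums over a symmetric range of integers *)

Definition sym_range (K : nat) : seq int :=
  [seq Posz i | i <- iota 0 K.+1] ++ [seq Negz i | i <- iota 0 K].

Lemma mem_sym_range (K : nat) (k : int) : (k \in sym_range K) = (`|k| <= K)%N.
Proof.
rewrite mem_cat; apply/orP/idP => [[] /mapP[i]|].
- by rewrite mem_iota => i_lt ->; lia.
- by rewrite mem_iota => i_lt ->; lia.
- case: k => k kK; [left|right]; apply/mapP; exists k; rewrite ?mem_iota//=.
Qed.

Lemma uniq_sym_range (K : nat) : uniq (sym_range K).
Proof.
rewrite cat_uniq !map_inj_uniq ?iota_uniq ?andbT; [|by move=> ? ? []..].
by apply/hasPn => _ /mapP[i _ ->]; apply/mapP => -[].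
Qed.

Lemma size_sym_range (K : nat) : size (sym_range K) = K.*2.+1.
Proof. by rewrite size_cat !size_map !size_iota; lia. Qed.

Lemma sum_sym_range (R : realType) (K : nat) (g : R -> R) :
  \sum_(k <- sym_range K) g `|k%:~R|
    = g 0 + 2 * \sum_(0 <= i < K) g i.+1%:R.
Proof.
rewrite big_cat !big_map -[iota 0 K.+1]/(0%N :: iota 1 K) big_cons /=.
rewrite mulr0z normr0 -addrA; congr (_ + _).
rewrite mulr_natl mulr2n; congr (_ + _).
  rewrite (iotaDl 1 0) big_map /index_iota subn0.
  by apply: eq_bigr => i _; rewrite ger0_norm ?ler0n.
rewrite /index_iota subn0; apply: eq_bigr => i _.
by rewrite NegzE mulrNz normrN ger0_norm ?ler0n.
Qed.

(** The terms vanish for [|k| > floor x], so the sum does not depend on [K]; with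
    [N = floor x] it is [x + 2 N x - N (N + 1)], and substituting [N = x - f]
    makes the terms linear in [x] cancel. *)
Lemma sum_tent (R : realType) (K : nat) (x : R) :
  0 <= x -> (Num.floor x <= K%:Z)%R ->
  \sum_(k <- sym_range K) Num.max 0 (x - `|k%:~R|)
    = x ^+ 2 + fracpart x * (1 - fracpart x).
Proof.
move=> x0 xK; rewrite (sum_sym_range K (fun y => Num.max 0 (x - y))).
have [N FN] : exists N, Num.floor x = Posz N.
  by have := x0; rewrite -floor_ge0; case: Num.floor => // N _; exists N.
have /andP[Nx xN] := floor_itv x; rewrite FN rmorphD /= -!pmulrn in Nx xN.
have NK : (N <= K)%N by rewrite FN in xK.
have tail : \sum_(N <= i < K) Num.max 0 (x - i.+1%:R) = 0 :> R.
  rewrite big_nat big1// => i /andP[Ni _]; apply/max_idPl.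
  by rewrite subr_le0 (le_trans (ltW xN))// natr1 ler_nat.
have head (M : nat) : (M <= N)%N ->
    \sum_(0 <= i < M) Num.max 0 (x - i.+1%:R) = M%:R * x - M%:R * (M%:R + 1) / 2.
  elim: M => [|M IH] MN; first by rewrite big_nil; lra.
  rewrite big_nat_recr//= IH 1?ltnW//.
  have : (M.+1%:R : R) <= N%:R by rewrite ler_nat.
  rewrite -natr1 => MN'; rewrite (max_idPr _); first by lra.
  lra.
rewrite (big_cat_nat (leq0n N) NK)/= tail head// subr0 (max_idPr x0) /fracpart FN.
by rewrite -pmulrn; lra.
Qed.

(** * Slicing the lattice into parallel lines *)

(** Under [q b - p a = 1], the index [k] is the value of [q n - p m] and [t] is
    the position along that line.  The bounds [lo k] and [hi k] are imposed on
    the abscissa [m = k a + t q], whence the affine change of variable in the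
    range of [t]. *)
Definition strips (R : realType) (p q a b : int) (K : nat) (lo hi : int -> R) :
    seq (int * int) :=
  [seq (k * a + t * q, k * b + t * p)
     | k <- sym_range K,
       t <- int_range ((lo k - (k * a)%:~R) / q%:~R)
                      ((hi k - (k * a)%:~R) / q%:~R)].

(** The matrix with columns [(a, b)] and [(q, p)] is unimodular, with inverse
    [(m, n) |-> (q n - p m, b m - a n)]: every lattice point is hit. *)
Lemma mem_strips (R : realType) (p q a b : int) (K : nat) (lo hi : int -> R)
    (m n : int) :
  0 < q -> q * b - p * a = 1 ->
  ((m, n) \in strips p q a b K lo hi) =
  (`|(q * n - p * m)%R| <= K)%N
    && (lo (q * n - p * m) < m%:~R <= hi (q * n - p * m)).
Proof.
move=> q0 det; have qR : 0 < (q%:~R : R) by rewrite ltr0z.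
have rangeE k t : (t \in int_range ((lo k - (k * a)%:~R) / q%:~R)
                      ((hi k - (k * a)%:~R) / q%:~R))
    = (lo k < (k * a + t * q)%:~R <= hi k).
  rewrite mem_int_range ltr_pdivrMr// ler_pdivlMr// rmorphD /= (rmorphM _ t q).
  by congr andb; apply/idP/idP => ?; lra.
apply/allpairsPdep/idP => [[k [t [kK]]]|/andP[kK lohi]].
  rewrite rangeE => lohi [-> ->].
  have -> : q * (k * b + t * p) - p * (k * a + t * q) = k.
    by rewrite -[RHS]mulr1 -det; ring.
  by rewrite lohi andbT -mem_sym_range.
have mE : (q * n - p * m) * a + (b * m - a * n) * q = m.
  by rewrite -[RHS]mulr1 -det; ring.
exists (q * n - p * m), (b * m - a * n).
rewrite mem_sym_range rangeE mE; split => //.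
by congr pair; rewrite -[LHS]mulr1 -det; ring.
Qed.

Lemma uniq_strips (R : realType) (p q a b : int) (K : nat) (lo hi : int -> R) :
  q * b - p * a = 1 -> uniq (strips p q a b K lo hi).
Proof.
move=> det; apply: allpairs_uniq_dep => [|k _|].
- exact: uniq_sym_range.
- exact: uniq_int_range.
move=> [k t] [k' t'] _ _ /= [em en].
have kE j i : j = q * (j * b + i * p) - p * (j * a + i * q).
  by rewrite -[LHS]mulr1 -det; ring.
have tE j i : i = b * (j * a + i * q) - a * (j * b + i * p).
  by rewrite -[LHS]mulr1 -det; ring.
have -> : k = k' by rewrite [LHS](kE k t) em en -kE.
by have -> : t = t' by rewrite [LHS](tE k t) em en -tE.
Qed.

(** One unit of rounding error for each of the [2 K + 1] lines. *)
Lemma size_strips (R : realType) (p q a b : int) (K : nat) (lo hi : int -> R) :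
  0 < q ->
  `|(size (strips p q a b K lo hi))%:R
     - \sum_(k <- sym_range K) Num.max 0 ((hi k - lo k) / q%:~R)|
    <= K.*2.+1%:R.
Proof.
move=> q0; rewrite size_allpairs_dep sumnE big_map natr_sum -sumrB.
apply: le_trans (ler_norm_sum _ _ _) _.
rewrite -size_sym_range -sum1_size natr_sum; apply: ler_sum => k _.
set c := (k * a)%:~R.
have := size_int_range ((lo k - c) / q%:~R) ((hi k - c) / q%:~R).
by rewrite -[X in Num.max 0 X]mulrBl opprB addrA subrK.
Qed.

(** * Bounding the cardinality of a finite set by lists *)

Lemma leq_size_fset_set (T : choiceType) (A : set T) (s : seq T) :
  finite_set A -> uniq s -> (forall z, z \in s -> A z) ->
  (size s <= #|` fset_set A|)%N.
Proof.
move=> finA us sA; apply: uniq_leq_size => // z zs.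
by rewrite in_fset_set//; apply/mem_set/sA.
Qed.

Lemma leq_fset_set_size (T : choiceType) (A : set T) (s : seq T) :
  finite_set A -> (forall z, A z -> z \in s) -> (#|` fset_set A| <= size s)%N.
Proof.
move=> finA As; apply: uniq_leq_size => [|z]; first exact: fset_uniq.
by rewrite in_fset_set// => /set_mem/As.
Qed.

(** * The sector seen on each line *)

(** The triangle inequality for [q (m, n) = m (q, p) + (0, q n - p m)].  Stated
    with squares, it follows from [|p| <= s], which bounds the cross term. *)
Lemma line_norm_sandwich (R : realType) (p q s m n : R) :
  0 <= s -> s ^+ 2 = p ^+ 2 + q ^+ 2 -> 0 <= m ->
  (s * m - `|q * n - p * m|) ^+ 2 <= q ^+ 2 * (m ^+ 2 + n ^+ 2)
    <= (s * m + `|q * n - p * m|) ^+ 2.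
Proof.
move=> s0 sE m0; set k := q * n - p * m.
have ps : `|p| <= s.
  rewrite -(ler_pXn2r (n := 2))// ?nnegrE// real_normK ?num_real//.
  by rewrite sE lerDl sqr_ge0.
have E : q ^+ 2 * (m ^+ 2 + n ^+ 2) = s ^+ 2 * m ^+ 2 + 2 * m * (p * k) + k ^+ 2.
  by rewrite sE /k; ring.
have pk : `|p * k| <= s * `|k| by rewrite normrM ler_wpM2r.
have /andP[pkl pku] : - (s * `|k|) <= p * k <= s * `|k| by rewrite -ler_norml.
have kk : `|k| ^+ 2 = k ^+ 2 by rewrite real_normK ?num_real.
have lower : 0 <= m * (p * k + s * `|k|) by rewrite mulr_ge0//; lra.
have upper : 0 <= m * (s * `|k| - p * k) by rewrite mulr_ge0//; lra.
by clearbody k; rewrite E sqrrB sqrrD kk exprMn; apply/andP; split; lra.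
Qed.

Definition cone_lo (R : realType) (q : int) (e : R) (k : int) : R :=
  `|k%:~R| / (q%:~R * e).

(** For [m > 0] the norm condition is implied by the bound with [c = -1] and
    implies the one with [c = 1]; [c = 0] gives the value entering the main
    term. *)
Definition disc_hi (R : realType) (p q : int) (r c : R) (k : int) : R :=
  (q%:~R * r + c * `|k%:~R|) / Num.sqrt (p%:~R ^+ 2 + q%:~R ^+ 2).

Lemma ler_sqrt_sqrD (R : realType) (x y : R) :
  0 <= y -> y <= Num.sqrt (x ^+ 2 + y ^+ 2).
Proof.
move=> y0; rewrite -{1}[y]ger0_norm// -sqrtr_sqr ler_sqrt ?lerDr ?sqr_ge0//.
by rewrite addr_ge0 ?sqr_ge0.
Qed.

(** Multiplying both conditions by [q] makes the line index [q n - p m] appear. *)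
Lemma Zpoints_Sect_slopeE (R : realType) (p q : int) (e r : R) (m n : int) :
  0 < q ->
  Zpoints (Sect (p%:~R / q%:~R) e r) (m, n) <->
  [/\ 0 < m,
      q%:~R ^+ 2 * (m%:~R ^+ 2 + n%:~R ^+ 2) <= (q%:~R * r) ^+ 2
    & `|(q * n - p * m)%:~R| < m%:~R * (q%:~R * e)].
Proof.
move=> q0; have Q0 : 0 < (q%:~R : R) by rewrite ltr0z.
have kE : `|(q * n - p * m)%:~R|
    = q%:~R * `|n%:~R - p%:~R / q%:~R * m%:~R| :> R.
  rewrite -{1}(gtr0_norm Q0) -normrM rmorphB !rmorphM /=.
  by congr (`| _ |); field; rewrite gt_eqF.
rewrite Zpoints_SectE /= exprMn ler_pM2l ?exprn_gt0// kE.
by rewrite [_ * (_ * e)]mulrCA ltr_pM2l.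
Qed.

(** A point of the sector has [m <= r], hence [|q n - p m| < m q e <= q e r]:
    this is why [K] lines on each side suffice. *)
Lemma Scount_strips (R : realType) (p q a b : int) (K : nat) (e r : R) :
  0 < q -> q * b - p * a = 1 -> 0 < e -> 0 < r ->
  Num.floor (q%:~R * e * r) <= K%:Z ->
  (size (strips p q a b K (cone_lo q e) (disc_hi p q r (-1)%R))
     <= Scount (p%:~R / q%:~R) e r
     <= size (strips p q a b K (cone_lo q e) (disc_hi p q r 1%R)))%N.
Proof.
move=> q0 det e0 r0 floorK.
have Q0 : 0 < (q%:~R : R) by rewrite ltr0z.
have Qe0 : 0 < q%:~R * e by rewrite mulr_gt0.
have Qr0 : 0 <= q%:~R * r by rewrite mulr_ge0// ltW.
pose s : R := Num.sqrt (p%:~R ^+ 2 + q%:~R ^+ 2).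
have s_gt0 : 0 < s by rewrite (lt_le_trans Q0)// ler_sqrt_sqrD// ltW.
have sE : s ^+ 2 = p%:~R ^+ 2 + q%:~R ^+ 2.
  by rewrite sqr_sqrtr// addr_ge0 ?sqr_ge0.
have normk (m n : int) :
    `|(q * n - p * m)%:~R| = `|q%:~R * n%:~R - p%:~R * m%:~R| :> R.
  by rewrite rmorphB !rmorphM.
apply/andP; split.
  apply: leq_size_fset_set; first exact: finite_Zpoints_Sect.
    exact: uniq_strips.
  move=> [m n]; rewrite mem_strips// => /andP[_ /andP[lom mhi]].
  have m0R : 0 < (m%:~R : R) by rewrite (le_lt_trans _ lom)// divr_ge0// ltW.
  apply/(Zpoints_Sect_slopeE _ _ _ _ _ q0); split.
  - by rewrite -(ltr0z R).
  - have /andP[_ up] := line_norm_sandwich (n%:~R) (ltW s_gt0) sE (ltW m0R).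
    apply: le_trans up _; rewrite ler_pXn2r ?nnegrE//.
      by move: mhi; rewrite /disc_hi -/s ler_pdivlMr// normk; lra.
    by rewrite addr_ge0// mulr_ge0// ltW.
  - by rewrite -ltr_pdivrMr.
apply: leq_fset_set_size; first exact: finite_Zpoints_Sect.
move=> [m n] /(Zpoints_Sect_slopeE _ _ _ _ _ q0)[m0 norm_le km].
have m0R : 0 <= (m%:~R : R) by rewrite ler0z ltW.
rewrite mem_strips// {1}/cone_lo ltr_pdivrMr// km /=; apply/andP; split.
  have mr : m%:~R <= r.
    rewrite -(ler_pXn2r (n := 2))// ?nnegrE ?(ltW r0)//.
    rewrite -(ler_pM2l (exprn_gt0 2 Q0)) -[X in _ <= X]exprMn.
    apply: le_trans norm_le.
    by rewrite ler_pM2l ?exprn_gt0// lerDl sqr_ge0.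
  rewrite -lez_nat (le_trans _ floorK)// floor_ge_int abszE intr_norm ltW//.
  by apply: lt_le_trans km _; rewrite mulrC ler_pM2l.
have /andP[low _] := line_norm_sandwich (n%:~R) (ltW s_gt0) sE m0R.
have := le_trans low norm_le.
rewrite -[X in X <= _]real_normK ?num_real//.
rewrite ler_pXn2r ?nnegrE// => /(le_trans (ler_norm _)).
by rewrite /disc_hi -/s ler_pdivlMr// normk; lra.
Qed.

(** * The main term and the error *)

(** The inner bound [cone_lo] meets [disc_hi] with [c = 0] exactly at [|k| = x],
    so the line lengths form a tent function of [k].  The error is [1] for
    rounding plus at most [|k| <= K] for the change of [c], on [2 K + 1]
    lines. *)
Lemma size_strips_tent (R : realType) (p q a b : int) (K : nat) (e r c : R)
    (D : R := p%:~R ^+ 2 + q%:~R ^+ 2)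
    (x : R := e * q%:~R ^+ 2 * r / Num.sqrt D) :
  0 < q -> 0 < e -> 0 < r -> Num.floor x <= K%:Z -> `|c| <= 1 ->
  `|(size (strips p q a b K (cone_lo q e) (disc_hi p q r c)))%:R
    - (e * q%:~R ^+ 2 * r ^+ 2 / D
        + 1 / (q%:~R ^+ 2 * e) * (fracpart x * (1 - fracpart x)))|
  <= K.*2.+1%:R * (K%:R + 1).
Proof.
move=> q0 e0 r0 floorK c1.
set Q : R := q%:~R; set s := Num.sqrt D.
have Q1 : 1 <= Q by rewrite /Q ler1z; lia.
have Q0 : 0 < Q by apply: lt_le_trans Q1.
have s1 : 1 <= s by rewrite (le_trans Q1)// ler_sqrt_sqrD// ltW.
have s0 : 0 < s by apply: lt_le_trans s1.
have DE : D = s ^+ 2 by rewrite sqr_sqrtr// addr_ge0 ?sqr_ge0.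
have x0 : 0 <= x by rewrite /x !mulr_ge0 ?invr_ge0 ?ltW// exprn_gt0.
pose len c' k := (disc_hi p q r c' k - cone_lo q e k) / Q.
have mainE : \sum_(k <- sym_range K) Num.max 0 (len 0 k)
    = e * Q ^+ 2 * r ^+ 2 / D
      + 1 / (Q ^+ 2 * e) * (fracpart x * (1 - fracpart x)).
  have termE k :
      Num.max 0 (len 0 k) = Num.max 0 (x - `|k%:~R|) / (Q ^+ 2 * e).
    rewrite [RHS]mulrC maxr_pMr ?invr_ge0 ?mulr_ge0 ?ltW ?exprn_gt0// mulr0.
    congr Num.max; rewrite /len /disc_hi /cone_lo /x -/D -/Q -/s; field.
    by rewrite !gt_eqF.
  rewrite (eq_bigr _ (fun k _ => termE k)) -mulr_suml sum_tent//.
  rewrite DE mulrDl; congr (_ + _); last by rewrite mul1r mulrC.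
  by rewrite /x -/Q -/s; field; rewrite !gt_eqF.
(* [max 0] is 1-Lipschitz, and [s q >= 1]. *)
have perturb k :
    `|Num.max 0 (len c k) - Num.max 0 (len 0 k)| <= `|k%:~R|.
  have : `|len c k - len 0 k| <= `|k%:~R|.
    have -> : len c k - len 0 k = c * `|k%:~R| / (s * Q).
      rewrite /len /disc_hi -/D -/Q -/s; field.
      by rewrite !gt_eqF.
    rewrite !normrM normr_id normfV ler_pdivrMr ?normr_gt0 ?mulf_neq0 ?gt_eqF//.
    rewrite mulrC ler_wpM2l// (le_trans c1)//.
    by rewrite gtr0_norm ?mulr_gt0// mulr_ege1.
  rewrite !ler_norml.
  by case: (leP 0 (len c k)) => ?; case: (leP 0 (len 0 k)) => ?; lra.
rewrite -mainE mulrDr mulr1 [leRHS]addrC.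
apply: le_trans (ler_distD (\sum_(k <- sym_range K) Num.max 0 (len c k)) _ _) _.
apply: lerD; first exact: size_strips.
rewrite -sumrB; apply: le_trans (ler_norm_sum _ _ _) _.
rewrite -size_sym_range -sum1_size natr_sum mulr_suml.
rewrite big_seq [leRHS]big_seq; apply: ler_sum => k kK.
apply: le_trans (perturb k) _; rewrite mul1r.
by rewrite -intr_norm -abszE -pmulrn ler_nat -mem_sym_range.
Qed.

(** Taking [K = floor (q e r)] serves both purposes: it covers all the lines that
    meet the sector, and [x <= q e r] since [q <= s], so it covers the support
    of the tent function as well. *)
Lemma Scount_estimate (R : realType) (p q : int) (e r : R)
    (D : R := p%:~R ^+ 2 + q%:~R ^+ 2)
    (x : R := e * q%:~R ^+ 2 * r / Num.sqrt D) :
  0 < q -> coprimez p q -> 0 < e -> 0 < r ->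
  `|(Scount (p%:~R / q%:~R) e r)%:R
     - (e * q%:~R ^+ 2 * r ^+ 2 / D
        + 1 / (q%:~R ^+ 2 * e) * (fracpart x * (1 - fracpart x)))|
  <= 4 * q%:~R ^+ 2 * (1 + (r * e) ^+ 2).
Proof.
move=> q0 /coprimezP[[u v] uv] e0 r0; rewrite /= in uv.
have det : q * v - p * - u = 1 by rewrite -uv; ring.
set Q : R := q%:~R.
have Q1 : 1 <= Q by rewrite /Q ler1z; lia.
have Q0 : 0 < Q by apply: lt_le_trans Q1.
have Qs : Q <= Num.sqrt D by rewrite ler_sqrt_sqrD// ltW.
have y0 : 0 <= Q * e * r by rewrite !mulr_ge0 ?ltW.
pose K := `|Num.floor (Q * e * r)|%N.
have KE : Posz K = Num.floor (Q * e * r) by rewrite gez0_abs ?floor_ge0.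
have floorK : Num.floor (Q * e * r) <= K%:Z by rewrite KE.
have floor_xK : Num.floor x <= K%:Z.
  rewrite KE; apply: le_floor; rewrite /x ler_pdivrMr ?(lt_le_trans Q0)// -/Q.
  have -> : e * Q ^+ 2 * r = Q * e * r * Q by ring.
  by rewrite ler_wpM2l.
have /andP[lower upper] := Scount_strips q0 det e0 r0 floorK.
have cN1 : `|-1 : R| <= 1 by rewrite normrN1.
have c1 : `|1 : R| <= 1 by rewrite normr1.
have := size_strips_tent (- u) v q0 e0 r0 floor_xK cN1.
have := size_strips_tent (- u) v q0 e0 r0 floor_xK c1.
rewrite ler_norml => /andP[_ szU]; rewrite ler_norml => /andP[szL _].
move: lower upper; rewrite -!(ler_nat R) => lower upper.
have bound : K.*2.+1%:R * (K%:R + 1) <= 4 * Q ^+ 2 * (1 + (r * e) ^+ 2).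
  have Ky : (K%:R : R) <= Q * e * r by rewrite pmulrn KE floor_le.
  have KKy : (K%:R : R) ^+ 2 <= (Q * e * r) ^+ 2 by rewrite ler_pXn2r ?nnegrE.
  have QQ1 : 1 <= Q ^+ 2 by rewrite exprn_ege1.
  have -> : 4 * Q ^+ 2 * (1 + (r * e) ^+ 2) = 4 * Q ^+ 2 + 4 * (Q * e * r) ^+ 2.
    by ring.
  rewrite -natr1 -muln2 natrM.
  (* [3 K <= 2 K^2 + 2], whose discriminant is negative. *)
  have := sqr_ge0 (4 * (K%:R : R) - 3); lra.
by rewrite ler_norml; apply/andP; split; lra.
Qed.

Theorem theorem1p5 (R : realType) (p q : int) (eps : R -> R) :
  0 < q -> coprimez p q -> (forall r : R, 0 < r -> 0 < eps r) ->
  let D : R := p%:~R ^+ 2 + q%:~R ^+ 2 in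
  let x (r : R) : R := eps r * q%:~R ^+ 2 * r / Num.sqrt D in
  (fun r : R => (Scount (p%:~R / q%:~R) (eps r) r)%:R : R) =
  (fun r : R => eps r * q%:~R ^+ 2 * r ^+ 2 / D
     + 1 / (q%:~R ^+ 2 * eps r) * (fracpart (x r) * (1 - fracpart (x r))))
  +O_ (+oo_R) (fun r : R => 1 + (r * eps r) ^+ 2).
Proof.
move=> q0 cop eps0 D x; apply/eqaddOP.
exists (4 * q%:~R ^+ 2); split; first exact: num_real.
move=> k kq; exists 0; split; first exact: num_real.
move=> r r0; have h0 : 0 <= 1 + (r * eps r) ^+ 2.
  by rewrite addr_ge0// sqr_ge0.
rewrite [X in _ <= _ * X]ger0_norm//.
apply: le_trans (Scount_estimate q0 cop (eps0 r r0) r0) _.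
by rewrite ler_wpM2r// ltW.
Qed.
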